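(* There exist absolute constants $\gamma>0$ and $t_0$ such that the following holds for every integer $t\ge t_0$. Let $p=t^2+1$, let $(R,B)$ be a feasible solution that is locally optimum for the $p$-swap heuristic, let $(R^*,B^* )$ be an optimum feasible solution, put $S=R\cup B$, $O=R^*\cup B^*$ and assume $S\cap O=\emptyset$. Let $T\subseteq S\cup O$ be a block, i.e. a set satisfying: (i) $|T\cap R|=|T\cap R^*|$ and $|T\cap B|=|T\cap B^*|$; (ii) for every $i\in S\cap T$, $\phi^{-1}(i)\subseteq T$, and for every $i^*\in O\cap T$, $\phi(i^* )\in T$; (iii) there is $\hat i\in T\cap S$ with $\deg(\hat i)>0$ such that every $i\in(T\cap S)\setminus\{\hat i\}$ is good or very good and all good facilities in $(T\cap S)\setminus\{\hat i\}$ have the same colour. Writing $T_R=T\cap R$, $T_B=T\cap B$, $T^*_R=T\cap R^*$, $T^*_B=T\cap B^*$, we have \[ 0\le \sum_{j\in N^*(T^*_R\cup T^*_B)}\Big[\Big(1+\frac{\gamma}{t}\Big)c^*_j-c_j\Big]+\sum_{j\in N(T_R\cup T_B)}\Big[\Big(4+\frac{\gamma}{t}\Big)c^*_j+\frac{\gamma}{t}c_j\Big]. \]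
   Context: Budgeted Red-Blue Median: clients $C$, red facilities $\mathcal R$, blue facilities $\mathcal B$ in a metric space with metric $d$, integers $k_r,k_b$; a feasible solution is $(R,B)$ with $R\subseteq\mathcal R$, $B\subseteq\mathcal B$, $|R|=k_r$, $|B|=k_b$, with cost $\sum_{j\in C}\min_{i\in R\cup B}d(i,j)$. Locally optimum for the $p$-swap heuristic: no feasible $(R',B')$ with $|R\setminus R'|\le p$, $|B\setminus B'|\le p$ has strictly smaller cost. For a client $j$, $s_j\in S$ is a facility of $S$ closest to $j$ and $o_j\in O$ a facility of $O$ closest to $j$ (ties broken arbitrarily); $c_j=d(j,s_j)$, $c^*_j=d(j,o_j)$. For $X\subseteq O$, $N^*(X)=\{j\in C:o_j\in X\}$; for $Y\subseteq S$, $N(Y)=\{j\in C:s_j\in Y\}$. The colour of a facility is red if it lies in $\mathcal R$, blue if in $\mathcal B$. $\phi:O\to S$ maps each facility of $O$ to a nearest facility of $S$ (ties broken arbitrarily); $\deg(i)=|\phi^{-1}(i)|$ for $i\in S$. A facility $i\in S$ is very good if $\deg(i)=0$, good if $\deg(i)>0$ and no $i^*\in\phi^{-1}(i)$ has the same colour as $i$, and bad otherwise. *)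

(* Defs.v *)
From HB Require Import structures.
From mathcomp Require Import all_boot all_order all_algebra.
From mathcomp Require Import reals topology.

Set Implicit Arguments.
Unset Strict Implicit.
Unset Printing Implicit Defensive.

Import Order.TTheory GRing.Theory Num.Theory.

Local Open Scope ring_scope.

(* Clients and facilities are abstract finite sets placed in the metric space by
   [cloc] and [floc]; no injectivity is required, so distinct clients or
   facilities may share a location. *)
Record instance (R : realType) := Instance {
  point : metricType R;
  client : finType;
  facility : finType;
  cloc : client -> point;
  floc : facility -> point;
  red : {set facility};
  blue : {set facility};
  red_blue_disjoint : [disjoint red & blue];
  kr : nat;
  kb : nat
}.

Section RedBlueMedian.
Variables (R : realType) (I : instance R).
Implicit Types (i : facility I) (j : client I).
Implicit Types (A S O T Rd Bl : {set facility I}).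
Implicit Types (s o : client I -> facility I) (phi : facility I -> facility I).

Definition dist i j : R := mdist (floc i) (cloc j).

Definition fdist i i' : R := mdist (floc i) (floc i').

(* The minimum over an empty set of facilities is 0 by convention. *)
Definition min_dist A j : R :=
  if [pick i in A] is Some i0 then \big[Num.min/dist i0 j]_(i in A) dist i j
  else 0.

Definition cost Rd Bl : R := \sum_(j : client I) min_dist (Rd :|: Bl) j.

Definition feasible Rd Bl : Prop :=
  [/\ Rd \subset red I, Bl \subset blue I, #|Rd| = kr I & #|Bl| = kb I].

Definition optimum Rd Bl : Prop :=
  feasible Rd Bl /\
  forall Rd' Bl', feasible Rd' Bl' -> cost Rd Bl <= cost Rd' Bl'.

Definition local_optimum (p : nat) Rd Bl : Prop :=
  feasible Rd Bl /\
  ~ exists Rd' Bl', [/\ feasible Rd' Bl', (#|Rd :\: Rd'| <= p)%N,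
      (#|Bl :\: Bl'| <= p)%N & cost Rd' Bl' < cost Rd Bl].

Definition closest_facility A s : Prop :=
  forall j, s j \in A /\ forall i, i \in A -> dist (s j) j <= dist i j.

(* [phi] is a total function, but only its values on [O] matter. *)
Definition nearest_map O S phi : Prop :=
  forall i', i' \in O ->
    phi i' \in S /\ forall i, i \in S -> fdist i' (phi i') <= fdist i' i.

Definition same_colour i i' : bool :=
  (i \in red I) && (i' \in red I) || (i \in blue I) && (i' \in blue I).

Definition fiber O phi i : {set facility I} := [set i' in O | phi i' == i].

Definition deg O phi i : nat := #|fiber O phi i|.

Definition very_good O phi i : Prop := deg O phi i = 0%N.

Definition good O phi i : Prop :=
  (0 < deg O phi i)%N /\
  ~ exists2 i', i' \in fiber O phi i & same_colour i' i.

Definition block Rd Bl Rd' Bl' phi T : Prop :=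
  let S := Rd :|: Bl in
  let O := Rd' :|: Bl' in
  [/\ T \subset S :|: O,
      #|T :&: Rd| = #|T :&: Rd'| /\ #|T :&: Bl| = #|T :&: Bl'|,
      (forall i, i \in S :&: T -> fiber O phi i \subset T) /\
      (forall i', i' \in O :&: T -> phi i' \in T) &
      exists hat, [/\ hat \in T :&: S,
        (0 < deg O phi hat)%N,
        (forall i, i \in (T :&: S) :\ hat ->
           good O phi i \/ very_good O phi i) &
        (forall i i', i \in (T :&: S) :\ hat -> i' \in (T :&: S) :\ hat ->
           good O phi i -> good O phi i' -> same_colour i i')]].

(* For [f] the closest-facility map of [S] (resp. [O]), [served f X] is N(X)
   (resp. N^*(X)). *)
Definition served (f : client I -> facility I) A : {set client I} :=
  [set j | f j \in A].

End RedBlueMedian.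

(* Main.v *)
Require Import Defs.
From HB Require Import structures.
From mathcomp Require Import all_boot all_order all_algebra.
From mathcomp Require Import reals topology.
From mathcomp Require Import ring lra zify.

Set Implicit Arguments.
Unset Strict Implicit.
Unset Printing Implicit Defensive.

Import Order.TTheory GRing.Theory Num.Theory.

Local Open Scope ring_scope.

(* Local optimality yields one inequality per test swap. When a swap closes [Y]
   and opens [X], a client [j] with [o j] in [X] changes by at most [c' j - c j];
   otherwise, if [s j] is closed, rerouting through [phi (o j)] costs at most
   [2 c' j], or [3 c' j + c j] if [phi (o j)] is closed too but the facility of its
   fibre closest to it is opened. The theorem follows from a nonnegative
   combination of such inequalities in which every facility of the block in [O] is
   opened with weight at least 1, every facility of the block in [S] is closed with
   weight at most [2 + O(1/t)], and the expensive rerouting has weight [O(1/t)], or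
   weight [1 + O(1/t)] with [o j] opened twice, since
   [2 (c' - c) + (3 c' + c) = 5 c' - c].
   If both colours have at most [t^2 + 1] facilities in the block, one swap
   exchanges all of it; if both have more than [t], swaps of at most two facilities
   per colour are averaged; otherwise one colour has at most [t] facilities, and it
   is exchanged at once. *)

(** * Nonnegative combinations of swap inequalities *)

Section WeightedSwaps.
Variables (R : realFieldType) (F C : finType) (S O : {set F}).
Variables (s o : C -> F) (c c' : C -> R).
Hypothesis s_in : forall j, s j \in S.
Hypothesis o_in : forall j, o j \in O.
Hypothesis c_ge0 : forall j, 0 <= c j.
Hypothesis c'_ge0 : forall j, 0 <= c' j.
Implicit Types (In Out : F -> R) (Bad : F -> F -> R).

(* A weighted family of swaps enters the estimate only through three numbers:
   [In x] and [Out f] are the total weights of the swaps opening [x] and closing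
   [f], and [Bad f x] is the weight of the swaps closing both [f] and [phi x]
   without opening [x], whose reassignment costs [3 c' + c] instead of [2 c']. *)
Definition swap_ineq In Out Bad : Prop :=
  0 <= \sum_j (In (o j) * Num.min 0 (c' j - c j) + Out (s j) * (2 * c' j)
               + Bad (s j) (o j) * (c' j + c j)).

(** Capping the gain of an opening at 0 gives [In] a nonpositive multiplier, while those of [Out]
    and [Bad] are nonnegative. Openings may therefore be forgotten and closings overestimated at no
    risk. *)
Lemma swap_ineq_le In Out Bad In' Out' Bad' :
  swap_ineq In Out Bad ->
  (forall x, x \in O -> In' x <= In x) ->
  (forall f, f \in S -> Out f <= Out' f) ->
  (forall f x, f \in S -> x \in O -> Bad f x <= Bad' f x) ->
  swap_ineq In' Out' Bad'.
Proof.
move=> ineq le_in le_out le_bad; apply: (le_trans ineq).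
apply: ler_sum => j _; apply: lerD; first apply: lerD.
- by apply: ler_wnM2r; [rewrite ge_min lexx | apply: le_in].
- by apply: ler_wpM2r; [rewrite mulr_ge0 | apply: le_out].
- by apply: ler_wpM2r; [rewrite addr_ge0 | apply: le_bad].
Qed.

Lemma swap_ineqD In Out Bad In' Out' Bad' :
  swap_ineq In Out Bad -> swap_ineq In' Out' Bad' ->
  swap_ineq (fun x => In x + In' x) (fun f => Out f + Out' f)
            (fun f x => Bad f x + Bad' f x).
Proof.
move=> ineq ineq'; apply: (le_trans (addr_ge0 ineq ineq')).
rewrite -big_split; apply: ler_sum => j _ /=; rewrite !mulrDl; lra.
Qed.

Lemma swap_ineq_sum (K : finType) (P : pred K) (w : K -> R)
    (In Out : K -> F -> R) (Bad : K -> F -> F -> R) :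
  (forall k, P k -> 0 <= w k) ->
  (forall k, P k -> swap_ineq (In k) (Out k) (Bad k)) ->
  swap_ineq (fun x => \sum_(k | P k) w k * In k x)
            (fun f => \sum_(k | P k) w k * Out k f)
            (fun f x => \sum_(k | P k) w k * Bad k f x).
Proof.
move=> w_ge0 ineq; rewrite /swap_ineq.
under eq_bigr => j _ do rewrite !mulr_suml -!big_split /=.
rewrite exchange_big /=; apply: sumr_ge0 => k Pk.
have := mulr_ge0 (w_ge0 k Pk) (ineq k Pk); rewrite mulr_sumr.
by congr (0 <= _); apply: eq_bigr => j _; rewrite !mulrDr !mulrA.
Qed.

(** Compared client by client, with [y] for [c' j] and [x] for [c j]. An ordinary client costs at
    most $(y-x)+2(2+e)y+e(y+x)$, and an exceptional one at most $2(y-x)+2(1+e)y+(1+e)(y+x)$. Both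
    equal $5y-x+3ey+ex$, which explains the hypothesis on [3 * e]. Without an opened [o j], the
    first term of the ordinary bound is 0. *)
Lemma swap_ineq_block In Out Bad (TS TO : {set F}) (e g : R) :
  0 <= e -> 3 * e <= g ->
  swap_ineq In Out Bad ->
  (forall x, 0 <= In x) ->
  (forall x, x \in TO -> 1 <= In x) ->
  (forall f, f \in TS -> Out f <= 2 + e) ->
  (forall f, f \notin TS -> Out f <= 0) ->
  (forall f x, f \notin TS -> Bad f x <= 0) ->
  (forall f x, f \in TS -> x \in O -> Bad f x <= e \/
     [/\ x \in TO, 2 <= In x, Out f <= 1 + e & Bad f x <= 1 + e]) ->
  0 <= \sum_(j | o j \in TO) ((1 + g) * c' j - c j)
       + \sum_(j | s j \in TS) ((4 + g) * c' j + g * c j).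
Proof.
move=> e_ge0 le_eg ineq In_ge0 In_ge1 Out_le Out_le0 Bad_le0 Bad_le.
apply: (le_trans ineq).
rewrite (big_mkcond (fun j => o j \in TO)) (big_mkcond (fun j => s j \in TS)).
rewrite -big_split; apply: ler_sum => j _ /=.
have := c_ge0 j; have := c'_ge0 j; move: (c j) (c' j) => x y y0 x0.
set m := Num.min _ _.
have m0 : m <= 0 by rewrite ge_min lexx.
have mxy : m <= y - x by rewrite ge_min lexx orbT.
(* Since [m] is nonpositive, a surplus weight of openings can be cut down to [a] before [m] is
   replaced by [y - x], whose sign is unknown. *)
have m_bound : forall a b : R, 0 <= a <= b -> b * m <= a * (y - x).
  move=> a b /andP[a0 ab]; apply: (@le_trans _ _ (a * m)).
    exact: ler_wnM2r.
  exact: ler_wpM2l.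
have g0 : 0 <= g by lra.
have gy : 3 * e * y <= g * y by apply: ler_wpM2r.
have gx : 3 * e * x <= g * x by apply: ler_wpM2r.
have ey : 0 <= e * y by apply: mulr_ge0.
have ex : 0 <= e * x by apply: mulr_ge0.
have IN0 : In (o j) * m <= 0 by apply: mulr_ge0_le0.
have IN : In (o j) * m <= if o j \in TO then y - x else 0.
  case: ifP => // oT; rewrite -[leRHS]mul1r; apply: m_bound.
  by rewrite ler01 In_ge1.
have yx0 : 0 <= y + x by rewrite addr_ge0.
case: (boolP (s j \in TS)) => sT; last first.
  have H1 : Out (s j) * (2 * y) <= 0.
    by apply: mulr_le0_ge0; [apply: Out_le0 | apply: mulr_ge0].
  have H2 : Bad (s j) (o j) * (y + x) <= 0.
    by apply: mulr_le0_ge0 => //; apply: Bad_le0.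
  by case: ifP IN => _ IN; lra.
case: (Bad_le _ _ sT (o_in j)) => [Bad_e|[oT In2 Out1 Bad1]].
  have H1 : Out (s j) * (2 * y) <= (2 + e) * (2 * y).
    by apply: ler_wpM2r; [rewrite mulr_ge0 | apply: Out_le].
  have H2 : Bad (s j) (o j) * (y + x) <= e * (y + x) by apply: ler_wpM2r.
  by case: ifP IN => _ IN; lra.
rewrite oT.
have H1 : Out (s j) * (2 * y) <= (1 + e) * (2 * y).
  by apply: ler_wpM2r; first rewrite mulr_ge0.
have H2 : Bad (s j) (o j) * (y + x) <= (1 + e) * (y + x) by apply: ler_wpM2r.
have H3 : In (o j) * m <= 2 * (y - x).
  by apply: m_bound; rewrite ler0n In2.
case: (leP x y) => xy; lra.
Qed.

End WeightedSwaps.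

(** * Averages over a finite set *)

Section Averages.
Variables (R : realFieldType) (F : finType).
Implicit Types (U : {set F}) (h : F -> R).

Definition avg U h : R := #|U|%:R^-1 * \sum_(k in U) h k.

Lemma avg_cst U (a : R) : (0 < #|U|)%N -> avg U (fun=> a) = a.
Proof.
move=> U0; rewrite /avg sumr_const -[a *+ _]mulr_natl mulKf//.
by rewrite pnatr_eq0 -lt0n.
Qed.

Lemma avgD U h h' : avg U (fun k => h k + h' k) = avg U h + avg U h'.
Proof. by rewrite /avg big_split mulrDr. Qed.

Lemma avgZ U (a : R) h : avg U (fun k => a * h k) = a * avg U h.
Proof. by rewrite /avg -mulr_sumr mulrCA. Qed.

Lemma avgZr U (a : R) h : avg U (fun k => h k * a) = avg U h * a.
Proof. by rewrite /avg -mulr_suml mulrA. Qed.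

Lemma eq_avg U h h' : h =1 h' -> avg U h = avg U h'.
Proof. by move=> eqh; rewrite /avg; under eq_bigr do rewrite eqh. Qed.

Lemma sum_indic U h y :
  \sum_(k in U) h k * (y == k)%:R = h y * (y \in U)%:R.
Proof.
case: (boolP (y \in U)) => yU; last first.
  rewrite mulr0 big1// => k kU; case: eqP => [yk|]; last by rewrite mulr0.
  by rewrite yk kU in yU.
rewrite (bigD1 y)//= eqxx big1 ?addr0// => k /andP[_ /negPf].
by rewrite eq_sym => ->; rewrite mulr0.
Qed.

Lemma avg_indic U h y :
  avg U (fun k => h k * (y == k)%:R) = h y * (y \in U)%:R / #|U|%:R.
Proof. by rewrite /avg sum_indic mulrC. Qed.

Lemma avg_indic1 U y : avg U (fun k => (y == k)%:R) = (y \in U)%:R / #|U|%:R.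
Proof.
rewrite -[(y \in U)%:R]mul1r -(avg_indic U (fun=> 1)) /avg; congr (_ * _).
by apply: eq_bigr => k _; rewrite mul1r.
Qed.

End Averages.

(** * Swaps inside a block, with the metric abstracted away *)

Section BlockCases.
Variables (R : realFieldType) (F C : finType) (S O : {set F}).
Variables (s o : C -> F) (c c' : C -> R).
Hypothesis s_in : forall j, s j \in S.
Hypothesis o_in : forall j, o j \in O.
Hypothesis c_ge0 : forall j, 0 <= c j.
Hypothesis c'_ge0 : forall j, 0 <= c' j.
Variables (phi cl : F -> F) (p t : nat).
Hypothesis cl_fiber :
  forall x, x \in O -> cl (phi x) \in O /\ phi (cl (phi x)) = phi x.
Hypothesis t_ge2 : (2 <= t)%N.
Hypothesis p_ge_t : (t <= p)%N.

Let p_gt0 : (0 < p)%N := leq_trans (ltnW t_ge2) p_ge_t.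

Local Notation sineq := (swap_ineq s o c c').
Local Notation sineq_le := (swap_ineq_le s_in o_in c_ge0 c'_ge0).
Local Notation sineq_block := (swap_ineq_block o_in c_ge0 c'_ge0).

(* [cl i] stands for a facility of [phi^-1(i)] closest to [i]: clients stranded
   by the closing of both [s j] and [phi (o j)] are sent to [cl (phi (o j))]. *)
Definition swaps_hold (A B A' B' : {set F}) : Prop :=
  forall XA XB YA YB : {set F},
    XA \subset A' -> XB \subset B' -> YA \subset A -> YB \subset B ->
    #|XA| = #|YA| -> #|XB| = #|YB| -> (#|YA| <= p)%N -> (#|YB| <= p)%N ->
    (forall x, x \in O -> phi x \in YA :|: YB -> x \notin XA :|: XB ->
       cl (phi x) \in XA :|: XB) ->
    sineq (fun x => (x \in XA :|: XB)%:R) (fun f => (f \in YA :|: YB)%:R)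
      (fun f x =>
         [&& f \in YA :|: YB, phi x \in YA :|: YB & x \notin XA :|: XB]%:R).

Lemma swaps_holdC A B A' B' : swaps_hold A B A' B' -> swaps_hold B A B' A'.
Proof.
move=> sw XB XA YB YA sXB sXA sYB sYA cB cA pB pA; rewrite [XB :|: _]setUC.
by rewrite [YB :|: _]setUC; apply: sw.
Qed.

Definition block_ineq (A B A' B' : {set F}) (g : R) : Prop :=
  0 <= \sum_(j | o j \in A' :|: B') ((1 + g) * c' j - c j)
       + \sum_(j | s j \in A :|: B) ((4 + g) * c' j + g * c j).

Lemma swap_ineq_avg (U : {set F}) (In Out : F -> F -> R)
    (Bad : F -> F -> F -> R) :
  (forall k, k \in U -> sineq (In k) (Out k) (Bad k)) ->
  sineq (fun x => avg U (In^~ x)) (fun f => avg U (Out^~ f))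
        (fun f x => avg U (fun k => Bad k f x)).
Proof.
move=> ineq; have w_ge0 (k : F) : k \in U -> 0 <= #|U|%:R^-1 :> R.
  by rewrite invr_ge0 ler0n.
apply: (sineq_le (swap_ineq_sum w_ge0 ineq)).
- by move=> x _; rewrite /avg mulr_sumr.
- by move=> f _; rewrite /avg mulr_sumr.
- by move=> f x _ _; rewrite /avg mulr_sumr.
Qed.

(** * The three cases for the sizes of the two colours *)

Section OneBlock.
Variables A B A' B' : {set F}.
Hypothesis sw : swaps_hold A B A' B'.
Hypothesis disjAB : [disjoint A & B].
Hypothesis subO : A' :|: B' \subset O.
Hypothesis cardA : #|A| = #|A'|.
Hypothesis cardB : #|B| = #|B'|.
Hypothesis phi_fib : forall x, x \in O -> phi x \in A :|: B -> x \in A' :|: B'.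

(** Exchanging the whole block strands nobody: by [phi_fib], when [phi x] is closed, [x] itself is
    opened. So [Bad] vanishes and the estimate holds with [e = 0]. *)
Lemma block_ineq_small (g : R) :
  0 <= g -> (#|A| <= p)%N -> (#|B| <= p)%N -> block_ineq A B A' B' g.
Proof.
move=> g0 pA pB.
have cond x : x \in O -> phi x \in A :|: B -> x \notin A' :|: B' ->
    cl (phi x) \in A' :|: B'.
  by move=> xO xf; rewrite phi_fib.
have ineq := sw (subxx _) (subxx _) (subxx _) (subxx _) (esym cardA)
  (esym cardB) pA pB cond.
apply: (sineq_block (lexx 0) _ ineq).
- by rewrite mulr0.
- by move=> x; rewrite ler0n.
- by move=> x ->.
- by move=> f _; rewrite addr0 ler_nat; case: (_ \in _).
- by move=> f /negPf->.
- by move=> f x /negPf->.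
- move=> f x fT xO; left; case: (boolP (phi x \in _)) => [xT|].
    by rewrite phi_fib ?andbF.
  by rewrite andbF.
Qed.

(** Each [z] in [B'] is swapped, with weight [a z], against a uniformly random facility of [V]. As
    [phi] never takes a value in [V], no rerouting target is closed. *)
Lemma pair_swaps (V : {set F}) (a : F -> R) :
  V \subset B -> (0 < #|V|)%N -> (forall x, x \in O -> phi x \notin V) ->
  (forall x, 0 <= a x) ->
  sineq (fun x => a x * (x \in B')%:R)
        (fun f => (\sum_(x in B') a x) * ((f \in V)%:R / #|V|%:R))
        (fun _ _ => 0).
Proof.
move=> sVB V0 VG a0.
have one z b : z \in B' -> b \in V ->
    sineq (fun x => (x == z)%:R) (fun f => (f == b)%:R) (fun _ _ => 0).
  move=> zB bV.
  have Pb x : x \in O -> (phi x == b) = false.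
    by move=> xO; apply: contraNF (VG x xO) => /eqP->.
  have := @sw set0 [set z] set0 [set b] (sub0set _) _ (sub0set _) _.
  rewrite !set0U !sub1set zB !cards1 cards0 (subsetP sVB)// => ineq.
  apply: (sineq_le (ineq _ _ _ _ _ _ _)) => //.
  - by move=> x xO; rewrite inE Pb.
  - by move=> x _; rewrite inE.
  - by move=> f _; rewrite inE.
  - by move=> f x _ xO; rewrite !inE Pb// andbF.
have avgb z : z \in B' ->
    sineq (fun x => (x == z)%:R) (fun f => (f \in V)%:R / #|V|%:R) (fun _ _ => 0).
  move=> zB; apply: (sineq_le (swap_ineq_avg (fun b => one z b zB))).
  - by move=> x _; rewrite avg_cst.
  - by move=> f _; rewrite avg_indic1.
  - by move=> f x _ _; rewrite avg_cst.
apply: (sineq_le (swap_ineq_sum (fun k _ => a0 k) avgb)) => // [x _|f _|f x _ _].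
- by rewrite sum_indic.
- by rewrite mulr_suml.
- by rewrite big1// => k _; rewrite mulr0.
Qed.

(* All of the small colour is closed at once, together with averaged very good
   facilities of the large colour that pay for opening the facilities [cl i];
   every facility of [B'] is then opened twice more, against [V]. *)
Lemma block_ineq_unbalanced :
  (#|A| <= t)%N -> (t ^ 2 + 2 <= #|B|)%N ->
  (#|B :&: (phi @: (A' :|: B'))| <= t + 1)%N ->
  block_ineq A B A' B' (18 / t%:R).
Proof.
move=> leA geB le_im.
set im := phi @: _ in le_im; pose V := B :\: im.
have cardV : (#|V| = #|B| - #|B :&: im|)%N by rewrite cardsD.
have sVB : V \subset B by apply: subsetDl.
have VG x : x \in O -> phi x \notin V.
  move=> xO; apply/negP; rewrite inE => /andP[/negP+ xB]; apply.
  by apply: imset_f; apply: phi_fib; rewrite // inE xB orbT.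
(* The facilities [cl i] that [A'] does not already provide; there are at most [#|A|], hence at most
   [t], of them. *)
pose Q := B' :&: (cl @: (A :&: (phi @: O))).
have leQ : (#|Q| <= #|A|)%N.
  apply: leq_trans (subset_leq_card (subsetIr _ _)) _.
  apply: leq_trans (leq_imset_card _ _) _.
  exact: subset_leq_card (subsetIl _ _).
set q := #|Q| in leQ.
(* The weight with which [f] is closed when [A] is closed together with a uniformly random
   [q]-subset of [U]; [z] marks the facilities whose clients this may strand. *)
pose h (U : {set F}) f : R := (f \in A)%:R + q%:R / #|U|%:R * (f \in U)%:R.
pose z x : R := ((phi x \in A) && (x \notin A'))%:R.
have big_swap (W : {set F}) : W \subset V -> #|W| = q ->
    sineq (fun x => (x \in A')%:R) (h W) (fun f x => z x * h W f).
  move=> sWV cW.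
  have hW f : h W f = (f \in A)%:R + (f \in W)%:R.
    rewrite /h -cW; case: (boolP (f \in W)) => fW; last by rewrite !mulr0.
    by rewrite mulr1 divff// pnatr_eq0 -lt0n (cardD1 f) fW.
  have WG x : x \in O -> (phi x \in W) = false.
    by move=> xO; apply: contraNF (VG x xO); apply: (subsetP sWV).
  have cond x : x \in O -> phi x \in A :|: W -> x \notin A' :|: Q ->
      cl (phi x) \in A' :|: Q.
    move=> xO; rewrite inE WG// orbF => xA _.
    have [clO phicl] := cl_fiber xO.
    have : cl (phi x) \in A' :|: B'.
      by apply: phi_fib; rewrite // phicl inE xA.
    rewrite !inE => /orP[->//|->]; apply/orP; right => /=.
    by apply: imset_f; rewrite inE xA imset_f.
  have ineq := sw (subxx _) (subsetIl _ _) (subxx _) (subset_trans sWV sVB)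
    (esym cardA) (esym cW) _ _ cond.
  apply: (sineq_le (ineq _ _)).
  - by apply: leq_trans leA _.
  - by rewrite cW; apply: leq_trans leQ _; apply: leq_trans leA _.
  - by move=> x _; rewrite in_setU ler_nat; case: (x \in A').
  - move=> f _; rewrite hW inE -natrD ler_nat.
    by case: (f \in A); case: (f \in W).
  - move=> f x _ xO; rewrite hW /z !in_setU (WG x xO) orbF -natrD -natrM ler_nat.
    by case: (f \in A); case: (f \in W); case: (x \in Q);
      case: (phi x \in A); case: (x \in A').
(* The random [q]-subset is produced by deleting uniformly chosen elements one at a time: an element
   of [U] survives one deletion with probability $(|U|-1)/|U|$, which turns $q/(|U|-1)$ into
   $q/|U|$. *)
have avg_swap k (U : {set F}) : U \subset V -> #|U| = (q + k)%N ->
    sineq (fun x => (x \in A')%:R) (h U) (fun f x => z x * h U f).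
  elim: k U => [|k IH] U sUV cU; first by apply: big_swap; rewrite ?cU ?addn0.
  have U0 : (0 < #|U|)%N by rewrite cU addnS.
  have IHu u : u \in U -> sineq (fun x => (x \in A')%:R) (h (U :\ u))
      (fun f x => z x * h (U :\ u) f).
    move=> uU; apply: IH; first exact: subset_trans (subsetDl _ _) sUV.
    by move: cU; rewrite (cardsD1 u) uU addnS => -[].
  have avg_h f : avg U (fun u => h (U :\ u) f) = h U f.
    transitivity (avg U (fun u => (f \in A)%:R
        + q%:R / (q + k)%:R * ((f \in U)%:R * (1 - (f == u)%:R)) : R)).
      rewrite /avg; congr (_ * _); apply: eq_bigr => u uU; rewrite /h.
      have -> : #|U :\ u| = (q + k)%N.
        by move: cU; rewrite (cardsD1 u) uU addnS => -[].
      congr (_ + _ * _); rewrite !inE; case: (f \in U); case: eqP => _ /=;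
      by rewrite ?subr0 ?subrr ?mulr1 ?mulr0.
    rewrite avgD avg_cst// !avgZ.
    have -> : avg U (fun u => 1 - (f == u)%:R : R) = 1 - (f \in U)%:R / #|U|%:R.
      rewrite avgD avg_cst//; congr (_ + _).
      by rewrite -avg_indic1 /avg -mulrN -sumrN.
    rewrite /h; congr (_ + _); case: (f \in U); last by rewrite !mul0r !mulr0.
    rewrite cU addnS mulr1 !mul1r.
    have [->|q0] := posnP q; first by rewrite !mul0r.
    have qk0 : (q + k)%:R != 0 :> R by rewrite pnatr_eq0; lia.
    have qk1 : (q + k).+1%:R != 0 :> R by rewrite pnatr_eq0.
    rewrite -natr1 in qk1 *; move: qk0 qk1; move: (q + k)%:R => y qk0 qk1.
    by field; rewrite qk1 qk0.
  apply: (sineq_le (swap_ineq_avg IHu)).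
  - by move=> x _; rewrite avg_cst.
  - by move=> f _; rewrite avg_h.
  - by move=> f x _ _; rewrite avgZ avg_h.
(* From $t^2+2$ facilities of [B], at most $t+1$ are lost to the image of [phi]. *)
have V_large : (t ^ 2 + 1 <= #|V| + t)%N by lia.
have leqV : (q <= #|V|)%N by nia.
have V0 : (0 < #|V|)%N by nia.
have VR0 : 0 < #|V|%:R :> R by rewrite ltr0n.
have tR0 : 0 < t%:R :> R by rewrite ltr0n; lia.
have ineq := swap_ineqD (avg_swap (#|V| - q)%N V (subxx _) _)
  (pair_swaps sVB V0 VG (fun=> ler0n R 2)).
have sum2 : \sum_(x in B') 2 = (2 * #|B|)%:R :> R.
  by rewrite sumr_const -cardB natrM mulr_natr.
have notVA f : f \in A -> (f \in V) = false.
  by move=> fA; rewrite inE (disjointFr disjAB fA) andbF.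
have e0 : 0 <= 6 / t%:R :> R by rewrite divr_ge0// ?ler0n.
(* The excess of $q+2|B|$ over $2|V|$ is at most $t+2(t+1)=3t+2$, and $t(3t+2)\le 6(t^2-t+1)\le
   6|V|$. *)
have key : (q + 2 * #|B|)%:R / #|V|%:R <= 2 + 6 / t%:R :> R.
  rewrite ler_pdivrMr// -(ler_pM2r tR0).
  have -> : (2 + 6 / t%:R) * #|V|%:R * t%:R = ((2 * t + 6) * #|V|)%:R :> R.
    by rewrite natrM natrD natrM; field; rewrite gt_eqF.
  rewrite -natrM ler_nat; nia.
have key1 : q%:R / #|V|%:R <= 6 / t%:R :> R.
  rewrite ler_pdivrMr// mulrAC ler_pdivlMr// -!natrM ler_nat; nia.
apply: (sineq_block e0 _ (ineq _)) => {ineq}.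
- by rewrite mulrA -natrM.
- by rewrite subnKC.
- by move=> x; rewrite addr_ge0 ?mulr_ge0 ?ler0n.
- by move=> x; rewrite inE => /orP[]->; rewrite -?natrM -natrD ler1n;
  rewrite addn_gt0 ?orbT.
- move=> f _; rewrite sum2 /h; case: (boolP (f \in A)) => fA.
    rewrite notVA// !(mul0r, mulr0, addr0) mulr1n; lra.
  rewrite add0r; case: (f \in V); last by rewrite !(mul0r, mulr0) addr0; lra.
  by rewrite mulr1 mul1r -mulrDl -natrD.
- move=> f; rewrite inE negb_or => /andP[fA fB].
  have fV : f \in V = false by apply: contraNF fB; apply: (subsetP sVB).
  by rewrite /h (negPf fA) fV !(mul0r, mulr0, addr0).
- move=> f x; rewrite inE negb_or => /andP[fA fB].
  have fV : f \in V = false by apply: contraNF fB; apply: (subsetP sVB).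
  by rewrite /h (negPf fA) fV !(mul0r, mulr0, addr0).
- move=> f x fT xO; rewrite addr0 /z.
  case: (boolP (phi x \in A)) => xA; last by left; rewrite mul0r.
  case: (boolP (x \in A')) => xA'; first by left; rewrite mul0r.
  rewrite mul1r /h; case: (boolP (f \in A)) => fA; last first.
    left; rewrite add0r; case: (f \in V); last by rewrite mulr0.
    by rewrite mulr1.
  (* The exceptional alternative: [x] must lie in [B'], so the swaps against [V] open it with weight
     2, while [f] in [A] is closed only by the big swap, with weight 1. *)
  have xT : x \in A' :|: B' by rewrite phi_fib// inE xA.
  right; rewrite notVA// !(mul0r, mulr0, addr0) mulr1n; split=> //; try lra.
  by move: xT; rewrite inE (negPf xA') /= => ->; rewrite add0r mulr1.
Qed.

(* [hat] is never closed. Closing a good [i] is paid for by opening [cl i] at the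
   same time and opening the rest of its fibre twice; as [cl i] is then opened
   only once more, the facilities of [B] are closed about twice on average. *)
Lemma block_ineq_balanced (hat : F) :
  (t < #|A|)%N -> (t < #|B|)%N ->
  (forall x, x \in A' :|: B' -> phi x != hat -> phi x \in A /\ x \in B') ->
  block_ineq A B A' B' (18 / t%:R).
Proof.
move=> gtA gtB goodA.
pose A1 := A :\ hat; pose B1 := B :\ hat.
(* The good facilities other than [hat]; by [goodA] all of them have the colour of [A]. *)
pose G := A1 :&: (phi @: (A' :|: B')).
have sA1 : A1 \subset A by apply: subsetDl.
have sB1 : B1 \subset B by apply: subsetDl.
have cA1 : (#|A| <= #|A1| + 1)%N.
  by rewrite (cardsD1 hat A) addnC leq_add2l leq_b1.
have cB1 : (#|B| <= #|B1| + 1)%N.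
  by rewrite (cardsD1 hat B) addnC leq_add2l leq_b1.
have tA1 : (t <= #|A1|)%N by rewrite -ltnS (leq_trans gtA)// -addn1.
have tB1 : (t <= #|B1|)%N by rewrite -ltnS (leq_trans gtB)// -addn1.
have t_gt0 : (0 < t)%N := ltnW t_ge2.
have A10 : (0 < #|A1|)%N := leq_trans t_gt0 tA1.
have B10 : (0 < #|B1|)%N := leq_trans t_gt0 tB1.
have B1_img x : x \in O -> phi x \notin B1.
  move=> xO; apply/negP; rewrite !inE => /andP[xh xB].
  have xT : x \in A' :|: B' by rewrite phi_fib// inE xB orbT.
  by have [xA _] := goodA x xT xh; rewrite (disjointFr disjAB xA) in xB.
have G_cl i : i \in G -> [/\ cl i \in B', phi (cl i) = i & i != hat].
  rewrite !inE => /andP[/andP[ih iA] /imsetP[x xT ix]].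
  have [clO phicl] := cl_fiber (subsetP subO x xT); rewrite -ix in clO phicl.
  have clT : cl i \in A' :|: B' by rewrite phi_fib// phicl inE iA.
  by have [|_ ?] := goodA _ clT; rewrite phicl.
have A1_img i x : i \in A1 -> x \in O -> phi x = i -> i \in G.
  move=> iA xO xi; rewrite inE iA -xi imset_f// phi_fib//.
  by rewrite xi inE (subsetP sA1).
pose z i x : R := [&& i \in G, phi x == i & x != cl i]%:R.
(* A good [i] needs [cl i] opened, and [b] is closed to balance the other colour; any other [i] is
   simply exchanged with [r]. The opening of [cl i] is not recorded, because the pair swaps below
   already give it weight 1. *)
have triple i r b : i \in A1 -> r \in A' -> b \in B1 ->
    sineq (fun x => (x == r)%:R)
      (fun f => (f == i)%:R + (i \in G)%:R * (f == b)%:R)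
      (fun f x => z i x * ((f == i)%:R + (f == b)%:R)).
  move=> iA rA bB.
  have bx x : x \in O -> (phi x == b) = false.
    by move=> xO; apply: contraNF (B1_img x xO) => /eqP->.
  have iA0 := subsetP sA1 i iA; have bB0 := subsetP sB1 b bB.
  case: (boolP (i \in G)) => iG.
    have [clB phicl _] := G_cl i iG.
    have cond x : x \in O -> phi x \in [set i] :|: [set b] ->
        x \notin [set r] :|: [set cl i] -> cl (phi x) \in [set r] :|: [set cl i].
      by move=> xO; rewrite !inE bx// orbF => /eqP-> _; rewrite eqxx orbT.
    have := @sw [set r] [set cl i] [set i] [set b].
    rewrite !sub1set !cards1 rA clB iA0 bB0 => ineq.
    apply: (sineq_le (ineq _ _ _ _ _ _ _ _ cond)) => //.
    - by move=> x _; rewrite !inE ler_nat; case: (x == r).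
    - move=> f _; rewrite !inE mul1r -natrD ler_nat.
      by case: (f == i); case: (f == b).
    - move=> f x _ xO; rewrite /z iG !inE bx// orbF -natrD -natrM ler_nat.
      by case: (f == i); case: (f == b); case: (phi x == i); case: (x == r);
         case: (x == cl i).
  have ix x : x \in O -> (phi x == i) = false.
    by move=> xO; apply: contraNF iG => /eqP; apply: A1_img.
  have := @sw [set r] set0 [set i] set0.
  rewrite !setU0 !sub1set !cards1 !cards0 !sub0set rA iA0 => ineq.
  apply: (sineq_le (ineq _ _ _ _ _ _ _ _ _)) => //.
  - by move=> x xO; rewrite inE ix.
  - by move=> x _; rewrite inE.
  - by move=> f _; rewrite inE mul0r addr0.
  - by move=> f x _ xO; rewrite /z (negPf iG) !inE ix// andbF mul0r.
have avg_b i r : i \in A1 -> r \in A' ->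
    sineq (fun x => (x == r)%:R)
      (fun f => (f == i)%:R + (i \in G)%:R * ((f \in B1)%:R / #|B1|%:R))
      (fun f x => z i x * ((f == i)%:R + (f \in B1)%:R / #|B1|%:R)).
  move=> iA rA; apply: (sineq_le (swap_ineq_avg (fun b => triple i r b iA rA))).
  - by move=> x _; rewrite avg_cst.
  - by move=> f _; rewrite avgD avg_cst// avgZ avg_indic1.
  - by move=> f x _ _; rewrite avgZ avgD avg_cst// avg_indic1.
(* Summing over [r] and then averaging over [i] opens each facility of [A'] with weight 1 and closes
   each facility of [A1] with weight $|A|/|A1|$, called [nu] below, which exceeds 1 only if [hat]
   lies in [A]. *)
have sum_r i : i \in A1 ->
    sineq (fun x => (x \in A')%:R)
      (fun f => #|A|%:R *
        ((f == i)%:R + (i \in G)%:R * ((f \in B1)%:R / #|B1|%:R)))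
      (fun f x => #|A|%:R * (z i x * ((f == i)%:R + (f \in B1)%:R / #|B1|%:R))).
  move=> iA.
  apply: (sineq_le (swap_ineq_sum (fun _ _ => ler01) (fun r => avg_b i r iA))).
  - by move=> x _; rewrite sum_indic mul1r.
  - by move=> f _; rewrite sumr_const -cardA mul1r [leRHS]mulr_natl.
  - by move=> f x _ _; rewrite sumr_const -cardA mul1r [leRHS]mulr_natl.
have avg_i := swap_ineq_avg sum_r.
pose a x : R := if (phi x != hat) && (x == cl (phi x)) then 1 else 2.
have a_ge1 x : 1 <= a x by rewrite /a; case: ifP => _; rewrite ?lexx ?ler1n.
have a_ge0 x : 0 <= a x by apply: le_trans ler01 (a_ge1 x).
(* Each good [i] saves one unit at [cl i], and distinct [i] have distinct [cl i] because [phi]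
   recovers [i]. *)
have sum_a : \sum_(x in B') a x <= 2 * #|B|%:R - #|G|%:R.
  pose H := [set x in B' | (phi x != hat) && (x == cl (phi x))].
  have GH : (#|G| <= #|H|)%N.
    have inj_cl : {in G &, injective cl}.
      move=> i k iG kG eq_cl; have [_ <- _] := G_cl i iG.
      by have [_ <- _] := G_cl k kG; rewrite eq_cl.
    rewrite -(card_in_imset inj_cl); apply: subset_leq_card.
    apply/subsetP => _ /imsetP[i iG ->]; have [clB phicl ih] := G_cl i iG.
    by rewrite inE clB phicl ih eqxx.
  have -> : \sum_(x in B') a x = 2 * #|B|%:R - #|H|%:R.
    have -> : #|H|%:R = \sum_(x in B') (if (phi x != hat) && (x == cl (phi x))
                                        then 1 else 0) :> R.
      rewrite -big_mkcondr /= -sum1_card natr_sum; apply: eq_bigl => x.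
      by rewrite inE.
    rewrite cardB mulr_natr -sumr_const -sumrB; apply: eq_bigr => x _.
    by rewrite /a; case: ifP => _; lra.
  by rewrite lerD2l lerN2 ler_nat.
have ineq := swap_ineqD avg_i (pair_swaps sB1 B10 B1_img a_ge0).
have avg_G : avg A1 (fun i => (i \in G)%:R) = #|G|%:R / #|A1|%:R :> R.
  rewrite /avg mulrC; congr (_ / _).
  rewrite -sum1_card natr_sum big_mkcond [RHS]big_mkcond.
  apply: eq_bigr => i _; rewrite !inE.
  by case: (i != hat); case: (i \in A); case: (i \in _).
have z_phi i x : z i x = z (phi x) x * (phi x == i)%:R.
  by rewrite /z; case: eqP => [->|_]; rewrite ?mulr1 ?eqxx // !(mulr0, andbF).
have z01 i x : 0 <= z i x <= 1.
  by rewrite /z; case: [&& _, _ & _]; rewrite ?lexx ?ler01.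
have A1R0 : 0 < #|A1|%:R :> R by rewrite ltr0n.
have B1R0 : 0 < #|B1|%:R :> R by rewrite ltr0n.
have tR0 : 0 < t%:R :> R by rewrite ltr0n.
have A_le : #|A|%:R <= #|A1|%:R + 1 :> R by rewrite natr1 ler_nat -addn1.
have B_le : #|B|%:R <= #|B1|%:R + 1 :> R by rewrite natr1 ler_nat -addn1.
have A1t : 1 <= 1 / t%:R * #|A1|%:R :> R.
  by rewrite mul1r mulrC ler_pdivlMr// mul1r ler_nat.
have B1t : 1 <= 1 / t%:R * #|B1|%:R :> R.
  by rewrite mul1r mulrC ler_pdivlMr// mul1r ler_nat.
pose nu : R := #|A|%:R / #|A1|%:R.
have nu_le : nu <= 1 + 1 / t%:R by rewrite /nu ler_pdivrMr// mulrDl; lra.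
have e0 : 0 <= 6 / t%:R :> R by rewrite divr_ge0// ?ler0n.
have Out_avg f : avg A1 (fun i => #|A|%:R * ((f == i)%:R + (i \in G)%:R *
    ((f \in B1)%:R / #|B1|%:R)))
    = nu * ((f \in A1)%:R + #|G|%:R * ((f \in B1)%:R / #|B1|%:R)).
  rewrite avgZ avgD avg_indic1 avgZr avg_G /nu.
  by field; rewrite !gt_eqF.
have Bad_avg f x : avg A1 (fun i => #|A|%:R *
    (z i x * ((f == i)%:R + (f \in B1)%:R / #|B1|%:R)))
    = nu * (z f x * (f \in A1)%:R
            + z (phi x) x * (phi x \in A1)%:R * ((f \in B1)%:R / #|B1|%:R)).
  rewrite avgZ (eq_avg _ (h' := fun i => z i x * (f == i)%:R
      + z (phi x) x * (phi x == i)%:R * ((f \in B1)%:R / #|B1|%:R))); last first.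
    by move=> i; rewrite mulrDr -z_phi.
  by rewrite avgD avgZr avgZ avg_indic avg_indic1 /nu; field; rewrite !gt_eqF.
have nu_ge0 : 0 <= nu by rewrite divr_ge0 ?ler0n.
have iB_le : #|B1|%:R^-1 <= 1 / t%:R :> R.
  by rewrite mul1r lef_pV2 ?posrE// ler_nat.
have it_le1 : 1 / t%:R <= 1 :> R by rewrite ler_pdivrMr// mul1r ler1n.
(* The triples close $\nu|G|\le|G|+1$ units of [B1]. The saving in [sum_a] cancels $|G|$, leaving at
   most $2|B|+1\le 2|B1|+3$ units spread over at least [t] facilities. *)
have Out_B : nu * (#|G|%:R / #|B1|%:R) + (\sum_(x in B') a x) / #|B1|%:R
    <= 2 + 6 / t%:R.
  have nuG : nu * #|G|%:R <= #|G|%:R + 1.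
    have G_le : #|G|%:R <= #|A1|%:R :> R.
      by rewrite ler_nat subset_leq_card// subsetIl.
    have := ler_wpM2r (ler0n R #|G|) A_le.
    by rewrite /nu mulrAC ler_pdivrMr//; lra.
  by rewrite mulrA -mulrDl ler_pdivrMr//; lra.
have disjA1B1 f : f \in A1 -> (f \in B1) = false.
  move=> fA; apply: contraTF (subsetP sA1 f fA) => /(subsetP sB1) fB.
  by rewrite (disjointFl disjAB fB).
apply: (sineq_block e0 _ ineq) => {ineq}.
- by rewrite mulrA -natrM.
- move=> x; rewrite avg_cst// addr_ge0 ?ler0n// mulr_ge0 ?ler0n//.
- move=> x; rewrite avg_cst// inE => /orP[]->; rewrite mulr1n.
    by rewrite lerDl mulr_ge0 ?ler0n.
  by rewrite mulr1 (le_trans (a_ge1 x))// lerDr ler0n.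
- move=> f _; rewrite Out_avg; case: (boolP (f \in A1)) => fA.
    by rewrite disjA1B1// !(mul0r, mulr0, addr0) mulr1n mulr1; lra.
  rewrite add0r; case: (f \in B1); last by rewrite !(mul0r, mulr0, addr0); lra.
  by rewrite !mul1r.
- move=> f; rewrite Out_avg inE negb_or => /andP[fA fB].
  have fA1 : f \in A1 = false by apply: contraNF fA; apply: (subsetP sA1).
  have fB1 : f \in B1 = false by apply: contraNF fB; apply: (subsetP sB1).
  by rewrite fA1 fB1 !(mul0r, mulr0, addr0).
- move=> f x; rewrite Bad_avg inE negb_or => /andP[fA fB].
  have fA1 : f \in A1 = false by apply: contraNF fA; apply: (subsetP sA1).
  have fB1 : f \in B1 = false by apply: contraNF fB; apply: (subsetP sB1).
  by rewrite fA1 fB1 !(mul0r, mulr0, addr0).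
- move=> f x fT xO; rewrite Bad_avg Out_avg avg_cst// addr0.
  (* A facility of [B1] is closed together with a given [phi x] only with weight at most
     $\nu/|B1|\le 2/t$. A facility of [A1] strands only clients of its own fibre, other than those
     of [cl f], and these are the facilities opened twice. *)
  case: (boolP (f \in A1)) => fA; last first.
    left; rewrite mulr0 add0r; case: (f \in B1); last by rewrite !(mul0r, mulr0).
    rewrite mul1r; apply: (@le_trans _ _ (2 * (1 / t%:R))); last by lra.
    apply: ler_pM => //; first by rewrite !mulr_ge0 ?invr_ge0 ?ler0n.
      by apply: le_trans nu_le _; lra.
    rewrite -[1 / _]mul1r; apply: ler_pM => //.
    - by rewrite mulr_ge0 ?ler0n.
    - by rewrite invr_ge0 ler0n.
    by have /andP[_] := z01 (phi x) x; case: (phi x \in A1); rewrite ?mulr1 ?mulr0.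
  rewrite disjA1B1// !(mul0r, mulr0, addr0) mulr1n !mulr1.
  case: (boolP [&& f \in G, phi x == f & x != cl f]) => zfx; last first.
    by left; rewrite /z (negPf zfx) mulr0.
  have /and3P[fG /eqP xf xcl] := zfx.
  have [_ _ fh] := G_cl f fG.
  have xT : x \in A' :|: B' by rewrite phi_fib// xf.
  have [_ xB] : phi x \in A /\ x \in B' by apply: goodA; rewrite ?xf.
  right; split=> //.
  - by rewrite xB mulr1 /a xf (negPf xcl) andbF lerDr ler0n.
  - by apply: le_trans nu_le _; lra.
  - by rewrite /z zfx mulr1; apply: le_trans nu_le _; lra.
Qed.
End OneBlock.

(** The colours are not symmetric here, but in either unbalanced case the large colour meets the
    image of [phi] in at most $t+1$ facilities: if it is [B], only [hat] can occur; if it is [A],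
    only [hat] and the images of the at most [t] facilities of [B']. *)
Lemma block_ineq_good (A B A' B' : {set F}) (hat : F) :
  p = (t ^ 2 + 1)%N -> swaps_hold A B A' B' ->
  [disjoint A & B] -> A' :|: B' \subset O ->
  #|A| = #|A'| -> #|B| = #|B'| ->
  (forall x, x \in O -> phi x \in A :|: B -> x \in A' :|: B') ->
  (forall x, x \in A' :|: B' -> phi x != hat -> phi x \in A /\ x \in B') ->
  block_ineq A B A' B' (18 / t%:R).
Proof.
move=> pE sw disjAB subO cardA cardB phi_fib goodA.
have [leA|gtA] := leqP #|A| t; last first.
  have [leB|gtB] := leqP #|B| t; last first.
    by apply: block_ineq_balanced goodA.
  have [leA|{}gtA] := leqP #|A| p.
    apply: block_ineq_small => //; last exact: leq_trans leB _.
    by rewrite divr_ge0 ?ler0n.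
  suff: block_ineq B A B' A' (18 / t%:R).
    by rewrite /block_ineq [B' :|: _]setUC [B :|: _]setUC.
  apply: block_ineq_unbalanced => //.
  - exact: swaps_holdC.
  - by rewrite disjoint_sym.
  - by rewrite setUC.
  - by move=> x xO; rewrite setUC [B' :|: _]setUC; apply: phi_fib.
  - by move: gtA; rewrite pE addn1 addn2.
  have sub : A :&: phi @: (B' :|: A') \subset hat |: phi @: B'.
    apply/subsetP => _ /setIP[_ /imsetP[x + ->]]; rewrite setUC !inE => xT.
    case: eqVneq => //= xh; have [|_ xB] := goodA x _ xh; first by rewrite inE.
    by rewrite imset_f.
  apply: leq_trans (subset_leq_card sub) _.
  rewrite cardsU1 addnC leq_add ?leq_b1//.
  by apply: leq_trans (leq_imset_card _ _) _; rewrite -cardB.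
have [leB|gtB] := leqP #|B| p.
  apply: block_ineq_small => //; last exact: leq_trans leA _.
  by rewrite divr_ge0 ?ler0n.
apply: block_ineq_unbalanced => //; first by move: gtB; rewrite pE addn1 addn2.
have sub : B :&: phi @: (A' :|: B') \subset [set hat].
  apply/subsetP => i /setIP[xB /imsetP[x xT ix]]; subst i.
  rewrite inE; apply/negPn/negP => xh; have [xA _] := goodA x xT xh.
  by rewrite (disjointFr disjAB xA) in xB.
by apply: leq_trans (subset_leq_card sub) _; rewrite cards1 addn1.
Qed.

End BlockCases.

(** * Minimum distances and closest facilities of fibres *)

Section MinDist.
Variables (R : realType) (I : instance R).
Implicit Types (A : {set facility I}) (i : facility I) (j : client I).

Lemma min_dist_le A i j : i \in A -> min_dist A j <= dist i j.
Proof.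
move=> iA; rewrite /min_dist; case: pickP => [i0 _|/(_ i)]; last by rewrite iA.
exact: bigmin_le_cond.
Qed.

Lemma le_min_dist A i j (x : R) :
  i \in A -> (forall k, k \in A -> x <= dist k j) -> x <= min_dist A j.
Proof.
move=> iA lex; rewrite /min_dist; case: pickP => [i0 i0A|/(_ i)]; last first.
  by rewrite iA.
by apply: le_bigmin => [|k kA]; apply: lex.
Qed.

(** [cl] depends on [phi x] only, so that a single opening serves all the clients stranded on one
    fibre. *)
Lemma closest_in_fiber (O : {set facility I}) (phi : facility I -> facility I) :
  exists cl : facility I -> facility I, forall x, x \in O ->
    [/\ cl (phi x) \in O, phi (cl (phi x)) = phi x &
        fdist (phi x) (cl (phi x)) <= fdist (phi x) x].
Proof.
pose cl i := if [pick x in fiber O phi i] is Some x0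
  then [arg min_(z < x0 in fiber O phi i) fdist i z]%O else i.
exists cl => x xO; rewrite /cl.
have xf : x \in fiber O phi (phi x) by rewrite inE xO eqxx.
case: pickP => [x0 x0f|/(_ x)]; last by rewrite xf.
case: arg_minP => // z; rewrite inE => /andP[zO /eqP zx] zmin.
by split=> //; apply: zmin.
Qed.

End MinDist.

(** * The inequality given by one test swap *)

Section TestSwap.
Variables (R : realType) (I : instance R).
Variables (Rd Bl Rd' Bl' : {set facility I}) (p : nat).
Variables (s o : client I -> facility I) (phi cl : facility I -> facility I).
Hypothesis locopt : local_optimum p Rd Bl.
Hypothesis feas' : feasible Rd' Bl'.
Hypothesis disjSO : (Rd :|: Bl) :&: (Rd' :|: Bl') = set0.
Hypothesis closest_s : closest_facility (Rd :|: Bl) s.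
Hypothesis closest_o : closest_facility (Rd' :|: Bl') o.
Hypothesis nearest_phi : nearest_map (Rd' :|: Bl') (Rd :|: Bl) phi.
Hypothesis closest_cl : forall x, x \in Rd' :|: Bl' ->
  fdist (phi x) (cl (phi x)) <= fdist (phi x) x.

Lemma card_swap (A A' X Y : {set facility I}) :
  [disjoint A & A'] -> X \subset A' -> Y \subset A -> #|X| = #|Y| ->
  #|A :\: Y :|: X| = #|A| /\ A :\: (A :\: Y :|: X) \subset Y.
Proof.
move=> disj sX sY cXY; split.
  rewrite cardsU; have -> : (A :\: Y) :&: X = set0.
    apply/setP => i; rewrite !inE; apply/negP => /andP[/andP[_ iA] iX].
    by move: (subsetP sX i iX); rewrite (disjointFr disj iA).
  rewrite cards0 subn0 cardsD (setIidPr sY) cXY subnK//.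
  exact: subset_leq_card.
apply/subsetP => i; rewrite !inE negb_or => /andP[/andP[+ _] iA].
by rewrite iA andbT negbK.
Qed.

(** The swapped solution is feasible and within reach of the heuristic, hence not cheaper; its extra
    cost is then bounded client by client. *)
Lemma swap_ineq_local_optimum (XR XB YR YB : {set facility I}) :
  XR \subset Rd' -> XB \subset Bl' -> YR \subset Rd -> YB \subset Bl ->
  #|XR| = #|YR| -> #|XB| = #|YB| -> (#|YR| <= p)%N -> (#|YB| <= p)%N ->
  (forall x, x \in Rd' :|: Bl' -> phi x \in YR :|: YB -> x \notin XR :|: XB ->
     cl (phi x) \in XR :|: XB) ->
  swap_ineq s o (fun j => dist (s j) j) (fun j => dist (o j) j)
    (fun x => (x \in XR :|: XB)%:R) (fun f => (f \in YR :|: YB)%:R)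
    (fun f x =>
       [&& f \in YR :|: YB, phi x \in YR :|: YB & x \notin XR :|: XB]%:R).
Proof.
move=> sXR sXB sYR sYB cR cB pR pB cond.
have [[sRd sBl cRd cBl] nobetter] := locopt.
have [sRd' sBl' _ _] := feas'.
have disj i : i \in Rd :|: Bl -> (i \in Rd' :|: Bl') = false.
  by move=> iS; have := in_set0 i; rewrite -disjSO inE iS.
have disjR : [disjoint Rd & Rd'].
  apply/pred0P => i /=; apply/negP => /andP[iR iR'].
  by have := disj i; rewrite !inE iR iR' => /(_ isT).
have disjB : [disjoint Bl & Bl'].
  apply/pred0P => i /=; apply/negP => /andP[iB iB'].
  by have := disj i; rewrite !inE iB iB' !orbT => /(_ isT).
have [cR1 sR1] := card_swap disjR sXR sYR cR.
have [cB1 sB1] := card_swap disjB sXB sYB cB.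
pose R1 := Rd :\: YR :|: XR; pose B1 := Bl :\: YB :|: XB.
have feas1 : feasible R1 B1.
  split; rewrite ?cR1 ?cB1// subUset.
    by rewrite (subset_trans (subsetDl _ _) sRd) (subset_trans sXR).
  by rewrite (subset_trans (subsetDl _ _) sBl) (subset_trans sXB).
have le_cost : cost Rd Bl <= cost R1 B1.
  rewrite leNgt; apply/negP => lt_cost; apply: nobetter; exists R1, B1.
  split=> //.
    exact: leq_trans (subset_leq_card sR1) _.
  exact: leq_trans (subset_leq_card sB1) _.
have in_new_S i : i \in Rd :|: Bl -> i \notin YR :|: YB -> i \in R1 :|: B1.
  rewrite !inE negb_or => /orP[]-> /andP[-> ->]; by rewrite ?orbT.
have in_new_X i : i \in XR :|: XB -> i \in R1 :|: B1.
  by rewrite !inE => /orP[]->; rewrite !orbT.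
rewrite /swap_ineq; move: le_cost; rewrite -subr_ge0 /cost -sumrB => /le_trans.
apply; apply: ler_sum => j _.
have [sS smin] := closest_s j; have [oO omin] := closest_o j.
have [phiS phimin] := nearest_phi oO.
have c_le : dist (s j) j <= min_dist (Rd :|: Bl) j by apply: le_min_dist sS smin.
have c0 : 0 <= dist (s j) j by apply: mdist_ge0.
have c'0 : 0 <= dist (o j) j by apply: mdist_ge0.
(* [phi (o j)] is at least as close to [o j] as [s j] is, so a detour through it has length at most
   $2c'_j+c_j$ and costs $2c'_j$ more than before. *)
have phi_le : fdist (o j) (phi (o j)) <= dist (o j) j + dist (s j) j.
  apply: le_trans (phimin _ sS) _.
  apply: le_trans (metric_triangle _ (cloc j) _) _.
  by rewrite lerD2l metric_sym.
set m := Num.min _ _; set N := min_dist (R1 :|: B1) j.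
have m0 : m = 0 \/ m = dist (o j) j - dist (s j) j.
  by rewrite /m; case: leP; [left|right].
have le_s : s j \notin YR :|: YB -> N <= dist (s j) j.
  by move=> sY; apply: min_dist_le; apply: in_new_S.
have le_o : o j \in XR :|: XB -> N <= dist (o j) j.
  by move=> oX; apply: min_dist_le; apply: in_new_X.
case: (boolP (s j \in YR :|: YB)) => sY; last first.
  have {}le_s := le_s sY.
  case: (boolP (o j \in XR :|: XB)) => oX; rewrite ?mul0r ?mul1r.
    by have {}le_o := le_o oX; case: m0 => ->; lra.
  lra.
case: (boolP (o j \in XR :|: XB)) => oX.
  have {}le_o := le_o oX; rewrite andbF mul0r !mul1r.
  by case: m0 => ->; lra.
rewrite andbT mul0r mul1r.
case: (boolP (phi (o j) \in YR :|: YB)) => phiY; last first.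
  have : N <= dist (phi (o j)) j by apply: min_dist_le; apply: in_new_S.
  have := metric_triangle (floc (phi (o j))) (floc (o j)) (cloc j).
  rewrite [mdist (floc (phi _)) (floc _)]metric_sym -/(fdist _ _) -!/(dist _ _).
  rewrite mul0r; lra.
(* As [cl (phi (o j))] is at least as close to [phi (o j)] as [o j] is, the path has length at most
   $c'_j+2(c'_j+c_j)$, an increase of $2c'_j+(c'_j+c_j)$. *)
have : N <= dist (cl (phi (o j))) j.
  by apply: min_dist_le; apply: in_new_X; apply: cond.
have := closest_cl oO.
have := metric_triangle (floc (cl (phi (o j)))) (floc (phi (o j))) (cloc j).
have := metric_triangle (floc (phi (o j))) (floc (o j)) (cloc j).
rewrite [mdist (floc (cl _)) (floc (phi _))]metric_sym.
rewrite [mdist (floc (phi _)) (floc (o _))]metric_sym.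
rewrite [fdist (phi (o j)) (o j)]metric_sym.
rewrite -!/(fdist _ _) -!/(dist _ _) mul1r; lra.
Qed.

End TestSwap.

(** * The theorem for a block *)

Theorem theorem4 (R : realType) :
  exists (gamma : R) (t0 : nat), 0 < gamma /\
  forall t : nat, (t0 <= t)%N ->
  forall (I : instance R) (Rd Bl Rd' Bl' : {set facility I}),
    local_optimum (t ^ 2 + 1)%N Rd Bl ->
    optimum Rd' Bl' ->
    (Rd :|: Bl) :&: (Rd' :|: Bl') = set0 ->
  forall (s o : client I -> facility I) (phi : facility I -> facility I),
    closest_facility (Rd :|: Bl) s ->
    closest_facility (Rd' :|: Bl') o ->
    nearest_map (Rd' :|: Bl') (Rd :|: Bl) phi ->
  forall T : {set facility I},
    block Rd Bl Rd' Bl' phi T ->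
    let c := fun j : client I => dist (s j) j in
    let c' := fun j : client I => dist (o j) j in
    0 <= \sum_(j in served o ((T :&: Rd') :|: (T :&: Bl')))
            ((1 + gamma / t%:R) * c' j - c j)
       + \sum_(j in served s ((T :&: Rd) :|: (T :&: Bl)))
            ((4 + gamma / t%:R) * c' j + gamma / t%:R * c j).
Proof.
(* 18 is three times 6: the weights are off by at most [6 / t], and the passage to the two sums
   triples this error. *)
exists 18, 2%N; split=> [|t t_ge2 I Rd Bl Rd' Bl' locopt [feas' _] disjSO s o phi].
  by rewrite ltr0n.
move=> closest_s closest_o nearest_phi T [_ [cardR cardB] [fib_in phi_inT]].
move=> [hat [_ _ goods same]]; lazy zeta.
pose c j := dist (s j) j; pose c' j := dist (o j) j.
have [[sRd sBl _ _] _] := locopt; have [sRd' sBl' _ _] := feas'.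
set p := (t ^ 2 + 1)%N in locopt.
have [cl clP] := closest_in_fiber (Rd' :|: Bl') phi.
have closest_cl x : x \in Rd' :|: Bl' ->
    fdist (phi x) (cl (phi x)) <= fdist (phi x) x by case/clP.
have cl_fiber x : x \in Rd' :|: Bl' ->
    cl (phi x) \in Rd' :|: Bl' /\ phi (cl (phi x)) = phi x by case/clP.
have s_in j : s j \in Rd :|: Bl by have [] := closest_s j.
have o_in j : o j \in Rd' :|: Bl' by have [] := closest_o j.
have c_ge0 j : 0 <= c j by apply: mdist_ge0.
have c'_ge0 j : 0 <= c' j by apply: mdist_ge0.
have p_ge_t : (t <= p)%N by rewrite /p; nia.
have rbF i : i \in red I -> (i \in blue I) = false.
  exact: disjointFr (red_blue_disjoint I).
have subI (A : {set facility I}) : T :&: A \subset A by apply: subsetIr.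
have sw : swaps_hold (Rd' :|: Bl') s o c c' phi cl p
    (T :&: Rd) (T :&: Bl) (T :&: Rd') (T :&: Bl').
  move=> XR XB YR YB sXR sXB sYR sYB.
  by apply: (swap_ineq_local_optimum locopt feas' disjSO closest_s closest_o
    nearest_phi closest_cl); apply: subset_trans (subI _).
have disjC (A B : {set facility I}) : A \subset red I -> B \subset blue I ->
    [disjoint T :&: A & T :&: B].
  move=> sA sB; apply/pred0P => i; rewrite !inE; apply/negP.
  move=> /andP[/andP[_ iA] /andP[_ iB]].
  by have := rbF i (subsetP sA i iA); rewrite (subsetP sB i iB).
have disjT := disjC _ _ sRd sBl.
have subO : (T :&: Rd') :|: (T :&: Bl') \subset Rd' :|: Bl'.
  by rewrite -setIUr subI.
have phi_in x : x \in (T :&: Rd') :|: (T :&: Bl') ->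
    phi x \in (T :&: Rd) :|: (T :&: Bl).
  rewrite -!setIUr => /setIP[xT xO]; apply/setIP; split.
    by apply: phi_inT; apply/setIP.
  by have [] := nearest_phi x xO.
have phi_fib x : x \in Rd' :|: Bl' -> phi x \in (T :&: Rd) :|: (T :&: Bl) ->
    x \in (T :&: Rd') :|: (T :&: Bl').
  rewrite -!setIUr => xO /setIP[xT xS]; apply/setIP; split=> //.
  have phixST : phi x \in (Rd :|: Bl) :&: T by apply/setIP.
  by apply: (subsetP (fib_in _ phixST)); rewrite inE xO eqxx.
have good_phi x : x \in (T :&: Rd') :|: (T :&: Bl') -> phi x != hat ->
    phi x \in (T :&: (Rd :|: Bl)) :\ hat /\ good (Rd' :|: Bl') phi (phi x).
  move=> xT xh; have xphi : phi x \in (T :&: (Rd :|: Bl)) :\ hat.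
    by rewrite !inE xh; move: (phi_in x xT); rewrite !inE; case: (phi x \in T).
  split=> //; case: (goods _ xphi) => // /eqP; rewrite cards_eq0 => /eqP f0.
  have := in_set0 x; rewrite -f0 inE eqxx andbT.
  by rewrite (subsetP subO).
suff ineq : block_ineq s o c c' (T :&: Rd) (T :&: Bl) (T :&: Rd') (T :&: Bl')
    (18 / t%:R).
  move: ineq; rewrite /block_ineq; congr (0 <= _ + _);
  by apply: eq_bigl => j; rewrite [RHS]inE.
(* One red value of [phi] other than [hat] forces, by [same], all such values to be red; if there is
   none, they are all blue. Goodness then puts their fibres in the opposite colour. *)
have [goodR|goodB] :
    (forall x, x \in (T :&: Rd') :|: (T :&: Bl') -> phi x != hat ->
       phi x \in T :&: Rd /\ x \in T :&: Bl') \/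
    (forall x, x \in (T :&: Bl') :|: (T :&: Rd') -> phi x != hat ->
       phi x \in T :&: Bl /\ x \in T :&: Rd').
  case: (boolP [exists x in (T :&: Rd') :|: (T :&: Bl'),
                  (phi x != hat) && (phi x \in Rd)]).
    case/exists_inP => x0 x0T /andP[x0h x0R]; left=> x xT xh.
    have [x0S x0good] := good_phi x0 x0T x0h; have [xS xgood] := good_phi x xT xh.
    have xred : phi x \in red I.
      have := same _ _ x0S xS x0good xgood; rewrite /same_colour.
      by rewrite (rbF _ (subsetP sRd _ x0R)) orbF => /andP[].
    have [_ nosame] := xgood.
    have xB : x \notin Rd'.
      apply/negP => xR; apply: nosame; exists x.
        by rewrite inE eqxx (subsetP subO).
      by rewrite /same_colour xred (subsetP sRd' _ xR).
    split; last by move: xT; rewrite !inE (negPf xB) andbF.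
    have := phi_in x xT; rewrite in_setU => /orP[//|/setIP[_ xBl]].
    by have := rbF _ xred; rewrite (subsetP sBl _ xBl).
  move/exists_inPn => noR; right=> x; rewrite setUC => xT xh.
  have [xS xgood] := good_phi x xT xh.
  have xBl : phi x \in T :&: Bl.
    have := phi_in x xT; rewrite in_setU => /orP[/setIP[_ xR]|//].
    by have := noR x xT; rewrite xh xR.
  have xblue : phi x \in blue I by have /setIP[_ /(subsetP sBl)] := xBl.
  have [_ nosame] := xgood.
  have xR : x \notin Bl'.
    apply/negP => xB; apply: nosame; exists x.
      by rewrite inE eqxx (subsetP subO).
    by rewrite /same_colour xblue (subsetP sBl' _ xB) orbT.
  by split=> //; move: xT; rewrite !inE (negPf xR) andbF orbF.
- exact: (block_ineq_good s_in o_in c_ge0 c'_ge0 cl_fiber t_ge2 p_ge_t erefl sw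
    disjT subO cardR cardB phi_fib goodR).
rewrite /block_ineq [(T :&: Rd') :|: _]setUC [(T :&: Rd) :|: _]setUC.
apply: (block_ineq_good s_in o_in c_ge0 c'_ge0 cl_fiber t_ge2 p_ge_t erefl
  (swaps_holdC sw) _ _ cardB cardR _ goodB).
- by rewrite disjoint_sym.
- by rewrite setUC.
- by move=> x; rewrite [(T :&: Bl) :|: _]setUC [(T :&: Bl') :|: _]setUC;
  apply: phi_fib.
Qed.
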